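(* Let $p,p'$ be coprime integers with $0<p<p'$, and let $a,b,c,L$ be integers with $1\le a,b,c\le p'-1$, $c=b\pm1$, $L\ge0$ and $L+a-b$ even. Then $$\chi^{p,p'}_{a,b,c}(L)=\sum_{h\in\mathcal P^{p,p'}_{a,b,c}(L)}q^{wt(h)},$$ where $\chi^{p,p'}_{a,b,c}(L)$ is the renormalised Forrester-Baxter generating function and $wt$ is the weight, both defined in the context.
   Context: $\mathcal P^{p,p'}_{a,b,c}(L)$ is the set of integer sequences $h=(h_0,\dots,h_L)$ with $1\le h_i\le p'-1$, $|h_{i+1}-h_i|=1$, $h_0=a$, $h_L=b$. Put $h_{L+1}=c$. Forrester-Baxter generating function. Define $c_{FB}(k-1,k,k+1)=c_{FB}(k+1,k,k-1)=\frac12$, $c_{FB}(k,k+1,k)=-\lfloor k(p'-p)/p'\rfloor$, $c_{FB}(k,k-1,k)=\lfloor k(p'-p)/p'\rfloor$, and $$\phi^{p,p'}_{a,b,c}(L)=\sum_{h\in\mathcal P^{p,p'}_{a,b,c}(L)}q^{\sum_{i=1}^L i\,c_{FB}(h_{i-1},h_i,h_{i+1})}.$$ With $\hat r(k)=\lfloor (p'-p)k/p'\rfloor$, define, for $c=b\pm1$, $$\chi^{p,p'}_{a,b,b\pm1}(L)=q^{-\hat r(c)(a-b\pm L)/2-(a-b)(a-c)/4}\,\phi^{p,p'}_{a,b,b\pm1}(L)$$ (the sign $\pm$ in the exponent being that in $c=b\pm1$). Weight $wt$. The band between heights $k$ and $k+1$ ($1\le k\le p'-2$) is even if $\lfloor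 kp/p'\rfloor=\lfloor (k+1)p/p'\rfloor$ and odd otherwise. For $1\le i\le L$ the vertex $v_i$ is formed by the segment from $(i-1,h_{i-1})$ to $(i,h_i)$ and the segment from $(i,h_i)$ to $(i+1,h_{i+1})$; its parity is that of the band between $h_i$ and $h_{i+1}$; it is straight if $h_{i-1}\ne h_{i+1}$ and a peak if $h_{i-1}=h_{i+1}$. A vertex is scoring if it is straight and odd, or a peak and even; otherwise non-scoring. With $x_i=\frac{i-(h_i-a)}2$, $y_i=\frac{i+(h_i-a)}2$, set $c_i=x_i$ if $v_i$ is scoring and $h_i=h_{i-1}+1$, $c_i=y_i$ if $v_i$ is scoring and $h_i=h_{i-1}-1$, and $c_i=0$ if $v_i$ is non-scoring. Then $wt(h)=\sum_{i=1}^L c_i$. *)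

(* Defs.v *)
From HB Require Import structures.
From mathcomp Require Import all_boot all_order all_algebra.
From mathcomp Require Import finmap.
From mathcomp Require Import monalg.

Set Implicit Arguments.
Unset Strict Implicit.
Unset Printing Implicit Defensive.

Import Order.TTheory GRing.Theory Num.Theory.
Local Open Scope ring_scope.

(* Finite formal sums of powers of q with rational exponents and integer
   coefficients (the group algebra Z[q^Q]): f@_e is the coefficient of q^e.
   The library puts a ring structure on {malg R[K]} only for monoids K without
   nontrivial units, which excludes (rat, +); hence the explicit product. *)
Definition qpow (e : rat) : {malg int[rat]} := << e >>.

Definition qmul (f g : {malg int[rat]}) : {malg int[rat]} :=
  \sum_(x <- msupp f) \sum_(y <- msupp g) << f@_x * g@_y *g x + y >>.

Section Paths.

Variables (p p' : nat) (a b c : int) (L : nat).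

(* h i is h_i for i <= L; heights lie in {0, ..., p' - 1}, and the value 0 is
   excluded in [paths]. *)
Implicit Type h : {ffun 'I_L.+1 -> 'I_p'}.

(* The height h_i as an integer, extended by h_{L+1} = c. *)
Definition height h (i : nat) : int :=
  if (i <= L)%N then (h (inord i) : nat)%:Z else c.

Definition paths : {set {ffun 'I_L.+1 -> 'I_p'}} :=
  [set h : {ffun 'I_L.+1 -> 'I_p'} |
    [&& [forall i : 'I_L.+1, (1 <= h i)%N],
        [forall i : 'I_L, `|height h i.+1 - height h i| == 1],
        height h 0 == a & height h L == b]].

(* floor ((p' - p) k / p') *)
Definition rhat (k : int) : int := ((p'%:Z - p%:Z) * k %/ p'%:Z)%Z.

(* c_FB (x, y, z), meaningful for |y - x| = |z - y| = 1. *)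
Definition cFB (x y z : int) : rat :=
  if x != z then 1 / 2
  else if y == x + 1 then - (rhat x)%:~R
  else (rhat x)%:~R.

Definition phi : {malg int[rat]} :=
  \sum_(h in paths)
    qpow (\sum_(1 <= i < L.+1)
      i%:R * cFB (height h i.-1) (height h i) (height h i.+1)).

(* c - b is the sign +1 or -1 in c = b +- 1. *)
Definition chi : {malg int[rat]} :=
  qmul (qpow (- ((rhat c)%:~R * (a - b + (c - b) * L%:Z)%:~R / 2)
              - ((a - b) * (a - c))%:~R / 4))
       phi.

(* Parity of the band between heights k and k + 1. *)
Definition band_even (k : int) : bool :=
  (k * p%:Z %/ p'%:Z)%Z == ((k + 1) * p%:Z %/ p'%:Z)%Z.

Definition vertex_even h (i : nat) : bool :=
  band_even (Num.min (height h i) (height h i.+1)).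

Definition straight h (i : nat) : bool := height h i.-1 != height h i.+1.

Definition peak h (i : nat) : bool := height h i.-1 == height h i.+1.

Definition scoring h (i : nat) : bool :=
  (straight h i && ~~ vertex_even h i) || (peak h i && vertex_even h i).

Definition xcoord h (i : nat) : rat := (i%:Z - (height h i - a))%:~R / 2.

Definition ycoord h (i : nat) : rat := (i%:Z + (height h i - a))%:~R / 2.

(* For a path, the last branch is the case h_i = h_{i-1} - 1. *)
Definition vertex_weight h (i : nat) : rat :=
  if ~~ scoring h i then 0
  else if height h i == height h i.-1 + 1 then xcoord h i
  else ycoord h i.

Definition wt h : rat := \sum_(1 <= i < L.+1) vertex_weight h i.

End Paths.

(* Main.v *)
(** The identity holds path by path. Cut the renormalising exponent off at
    step n by putting (h_n, h_{n+1}) in place of (b, c) and n in place of L; it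
    vanishes at n = 0 since h_0 = a. Its increment from n to n + 1, added to
    (n + 1) c_FB(h_n, h_{n+1}, h_{n+2}), is exactly the weight of the vertex
    v_{n+1}, because rhat jumps by 1 across even bands and by 0 across odd
    ones. *)

Require Import Defs.
From HB Require Import structures.
From mathcomp Require Import all_boot all_order all_algebra.
From mathcomp Require Import finmap.
From mathcomp Require Import monalg.
From mathcomp Require Import zify ring.

Set Implicit Arguments.
Unset Strict Implicit.
Unset Printing Implicit Defensive.

Import Order.TTheory GRing.Theory Num.Theory.
Local Open Scope ring_scope.

(** The support of [qpow e] is the single exponent [e], with coefficient 1, so the outer sum of
    [qmul] has one term; the inner one is the expansion of [f] over its support, translated by
    [e]. *)
Lemma mcoeff_qmul_qpow (e : rat) (f : {malg int[rat]}) (z : rat) :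
  (qmul (qpow e) f)@_z = f@_(z - e).
Proof.
rewrite /qmul /qpow msuppU oner_eq0 big_seq_fset1 mcoeffUU raddf_sum /=.
rewrite [in RHS](monalgE f) raddf_sum /=.
apply: eq_bigr => y _; rewrite !mcoeffU mul1r; congr (_ *+ (_ : bool)).
by rewrite eq_sym [RHS]eq_sym subr_eq addrC.
Qed.

Lemma qmul_qpow_sum (I : finType) (P : pred I) (e : rat) (g : I -> rat) :
  qmul (qpow e) (\sum_(i | P i) qpow (g i)) = \sum_(i | P i) qpow (e + g i).
Proof.
apply/malgP => z; rewrite mcoeff_qmul_qpow !raddf_sum /=.
apply: eq_bigr => i _; rewrite !mcoeffU; congr (_ *+ (_ : bool)).
by rewrite eq_sym subr_eq eq_sym addrC.
Qed.

Section Heights.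

Variables (p p' : nat).
Hypotheses (hcop : coprime p p') (hp : (0 < p)%N) (hpp' : (p < p')%N).

(** Since [(p' - p) k = k p' - k p], the matter is the floor of [- k p / p']. By coprimality
    [k p / p'] is not an integer for [0 < k < p'], so negating it costs the extra [- 1]. *)
Lemma rhatE (k : int) :
  1 <= k <= p'%:Z - 1 -> rhat p p' k = k - 1 - (k * p%:Z %/ p'%:Z)%Z.
Proof.
move=> /andP[k1 k2]; have p'0 : p'%:Z != 0 by lia.
set F := (_ %/ _)%Z; pose m := (k * p%:Z %% p'%:Z)%Z.
have kpE : k * p%:Z = F * p'%:Z + m := divz_eq _ _.
have m_gt0 : 0 < m.
  rewrite lt_neqAle modz_ge0 // andbT eq_sym; apply/negP => /eqP m0.
  have : (p'%:Z %| k * p%:Z)%Z by apply/dvdz_mod0P.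
  (* A zero remainder would make [k] a multiple of [p'], impossible strictly between 0 and [p']. *)
  rewrite Gauss_dvdzl ?coprimezE /= 1?coprime_sym //.
  move=> /dvdzP[q kq]; have [q0|q1] : q <= 0 \/ 1 <= q by lia.
    by nia.
  by nia.
have m_lt : m < p'%:Z by apply: ltz_pmod; lia.
rewrite /rhat.
have -> : (p'%:Z - p%:Z) * k = (k - 1 - F) * p'%:Z + (p'%:Z - m).
  by rewrite mulrBl [p%:Z * k]mulrC kpE; ring.
by rewrite divzMDl // (@divz_small (p'%:Z - m)) ?addr0 //; lia.
Qed.

Lemma rhat_succ (k : int) :
  1 <= k -> k + 1 <= p'%:Z - 1 ->
  rhat p p' (k + 1) = rhat p p' k + (band_even p p' k)%:Z.
Proof.
move=> k1 k2; rewrite !rhatE; [|lia|lia]; rewrite /band_even.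
have p'0 : p'%:Z != 0 by lia.
have p'_gt0 : 0 < p'%:Z by lia.
have := lez_floor (k * p%:Z) p'0; have := ltz_ceil (k * p%:Z) p'_gt0.
have := lez_floor ((k + 1) * p%:Z) p'0.
have := ltz_ceil ((k + 1) * p%:Z) p'_gt0.
set F := ((k * _) %/ _)%Z; set G := ((_ + 1) * _ %/ _)%Z.
case: eqP => [->|neq] /= *; first lia.
suff -> : G = F + 1 by lia.
(* As [0 < p < p'], the floor grows by 0 or 1; growth by 1 is an odd band and cancels the growth of
   [k - 1] in [rhatE]. *)
have : F < G + 1 by nia.
have : G < F + 2 by nia.
by move: neq; lia.
Qed.

Variables (a c : int) (L : nat) (h : {ffun 'I_L.+1 -> 'I_p'}).

Local Notation H := (height c h).

Hypotheses (H_range : forall i, (i <= L.+1)%N -> 1 <= H i <= p'%:Z - 1)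
           (H_step : forall i, (i <= L)%N -> `|H i.+1 - H i| = 1)
           (H0 : H 0 = a).

Definition norm_exp (n : nat) : rat :=
  - ((rhat p p' (H n.+1))%:~R * (a - H n + (H n.+1 - H n) * n%:Z)%:~R / 2)
  - ((a - H n) * (a - H n.+1))%:~R / 4.

Lemma norm_exp_succ (n : nat) : (n < L)%N ->
  norm_exp n.+1 + n.+1%:R * cFB p p' (H n) (H n.+1) (H n.+2)
  = norm_exp n + vertex_weight p a c h n.+1.
Proof.
move=> ltnL.
have := H_range (ltnW (ltnW ltnL : (n.+1 <= L.+1)%N)).
have := H_range (ltnW ltnL : (n.+1 <= L.+1)%N).
have := H_range (ltnL : (n.+2 <= L.+1)%N).
have := H_step (ltnW ltnL); have := H_step ltnL.
rewrite /norm_exp /vertex_weight /scoring /straight /peak /vertex_even.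
rewrite /xcoord /ycoord /cFB /=.
move: (H n) (H n.+1) (H n.+2) => x y z dz dy zr yr xr.
(* Four vertex shapes. In each, [rhat] at the upper end of the band after the vertex is rewritten
   through the lower end; the remaining [rhat] cancels, leaving a rational identity for each band
   parity. *)
have [yx|yx] : y = x + 1 \/ x = y + 1 by lia.
- have [zy|zy] : z = y + 1 \/ y = z + 1 by lia.
  + have -> : (x != z) by lia.
    have -> : Num.min y z = y by lia.
    have -> : x == z = false by lia.
    have -> : y == x + 1 by lia.
    rewrite /= orbF zy yx rhat_succ; [|lia|lia].
    by case: band_even => /=; rewrite ?(rmorphM, rmorphD, rmorphB) /= -?natr1; field.
  + have zx : z = x by lia.
    rewrite zx eqxx /= yx eqxx.
    have -> : Num.min (x + 1) x = x by lia.
    rewrite rhat_succ; [|lia|lia].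
    by case: band_even => /=; rewrite ?(rmorphM, rmorphD, rmorphB) /= -?natr1; field.
- have -> : y == x + 1 = false by lia.
  have [zy|zy] : z = y + 1 \/ y = z + 1 by lia.
  + have zx : z = x by lia.
    rewrite zx eqxx /= yx.
    have -> : Num.min y (y + 1) = y by lia.
    rewrite rhat_succ; [|lia|lia].
    by case: band_even => /=; rewrite ?(rmorphM, rmorphD, rmorphB) /= -?natr1; field.
  + have -> : (x != z) by lia.
    have -> : Num.min y z = z by lia.
    have -> : x == z = false by lia.
    rewrite /= orbF yx zy rhat_succ; [|lia|lia].
    by case: band_even => /=; rewrite ?(rmorphM, rmorphD, rmorphB) /= -?natr1; field.
Qed.

Lemma norm_exp_partial_wt (n : nat) : (n <= L)%N ->
  norm_exp n + \sum_(1 <= i < n.+1) i%:R * cFB p p' (H i.-1) (H i) (H i.+1)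
  = \sum_(1 <= i < n.+1) vertex_weight p a c h i.
Proof.
elim: n => [_|n IHn ltnL].
  by rewrite !big_geq // /norm_exp H0 subrr !mul0r !mulr0 !mul0r !oppr0 !addr0.
rewrite [in LHS]big_nat_recr // [in RHS]big_nat_recr //= -IHn 1?ltnW //.
by rewrite addrCA norm_exp_succ // addrCA addrA.
Qed.

End Heights.

Theorem mainTheorem2 (p p' : nat) (a b c : int) (L : nat)
  (hcop : coprime p p') (hp : (0 < p)%N) (hpp' : (p < p')%N)
  (ha : 1 <= a <= p'%:Z - 1) (hb : 1 <= b <= p'%:Z - 1)
  (hc : 1 <= c <= p'%:Z - 1)
  (hcb : c = b + 1 \/ c = b - 1)
  (heven : (2 %| L%:Z + a - b)%Z) :
  chi p p' a b c L =
    \sum_(h in paths p' a b c L) qpow (wt p a c h).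
Proof.
rewrite /chi /phi qmul_qpow_sum; apply: eq_bigr => h.
rewrite inE => /and4P[/forallP h_ge1 /forallP h_step /eqP h0 /eqP hL].
have hLS : height c h L.+1 = c by rewrite /height ltnn.
(* At [n = L] the cut-off exponent is the one in [chi]. *)
congr qpow; rewrite /wt -(@norm_exp_partial_wt p p') // /norm_exp ?hL ?hLS //.
(* The appended height [c] is the boundary case: its range is [hc], and the last step is [hcb]. *)
- move=> i; rewrite leq_eqVlt => /predU1P[->|ltiL]; first by rewrite hLS.
  rewrite /height -ltnS ltiL; have := h_ge1 (inord i).
  by case: (h (inord i)) => m /= ltm; lia.
- move=> i; rewrite leq_eqVlt => /predU1P[->|ltiL].
    by rewrite hLS hL; lia.
  exact/eqP/(h_step (Ordinal ltiL)).
Qed.
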